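(* Let $\sigma^2>0$, $N>0$, $0<L<\infty$, and for $p\ge0$, $\kappa>0$ let $D(p,\kappa)=\sigma^2\left(1+\frac{p}{N}\right)^{-\kappa}$ (the distortion function of a Gaussian source with variance $\sigma^2$ over a Gaussian channel with noise power $N$). Let $p(z)>0$ and $\kappa(z)>0$ for $z\in(0,L]$ satisfy, for some real constant $\beta$, $$D(p(z),\kappa(z))-\frac{\partial D}{\partial\kappa}(p(z),\kappa(z))\,\kappa(z)+\beta=0,\qquad z\in(0,L].$$ Then $-\sigma^2<\beta<0$ and $$\kappa(z)=-\frac{W_{-1}\!\left(\dfrac{\beta}{\sigma^2 e}\right)+1}{\ln\!\left(1+\dfrac{p(z)}{N}\right)},\qquad z\in(0,L].$$ In particular $\kappa$ is a decreasing function of $z$ whenever $p$ is an increasing function of $z$, and vice versa. Moreover the instantaneous distortion is constant: $$D(p(z),\kappa(z))=\sigma^2\exp\!\left(W_{-1}\!\left(\frac{\beta}{\sigma^2 e}\right)+1\right),\qquad z\in(0,L].$$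
   Context: $W_{-1}$ denotes the lower real branch of the Lambert $W$ function: for $-1/e<x<0$, $W_{-1}(x)$ is the unique real $w<-1$ with $we^{w}=x$. The function $D(p,\kappa)$ is the solution $D$ of $\tfrac12\log_2(\sigma^2/D)=\kappa\cdot\tfrac12\log_2(1+p/N)$. Here $z$ is the battery charge, $p(z)$ the transmission power policy and $\kappa(z)$ the mismatch factor policy (channel symbols per source symbol). *)

(* Defs.v *)
From HB Require Import structures.
From mathcomp Require Import all_boot all_order all_algebra.
From mathcomp Require Import all_classical all_reals all_analysis.

Set Implicit Arguments.
Unset Strict Implicit.
Unset Printing Implicit Defensive.

Import Order.TTheory GRing.Theory Num.Theory.
Import numFieldNormedType.Exports.

Local Open Scope classical_set_scope.
Local Open Scope ring_scope.

(* The solution D of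
   1/2 log_2 (sigma^2 / D) = kappa * 1/2 log_2 (1 + p / N). *)
Definition distortion {R : realType} (sigma N p kappa : R) : R :=
  sigma ^+ 2 * (1 + p / N) `^ (- kappa).

(* Lower real branch of the Lambert W function: the unique w < -1 with
   w * e^w = x when -1/e < x < 0. Outside that interval no such w exists and
   the value is the default 0. *)
Definition lambertWm1 {R : realType} (x : R) : R :=
  xget 0 [set w : R | w < -1 /\ w * expR w = x].

(* Main.v *)
(* With t = kappa ln(1 + p/N) the hypothesis reads sigma^2 (1 + t) e^(-t) = - beta,
   so w = - (t + 1) is the solution below -1 of w e^w = beta / (sigma^2 e).
   Hence t does not depend on z, and both the distortion sigma^2 e^(-t) and the
   product kappa ln(1 + p/N) are constant. *)

Require Import Defs.
From HB Require Import structures.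
From mathcomp Require Import all_boot all_order all_algebra.
From mathcomp Require Import all_classical all_reals all_analysis.
From mathcomp Require Import ring lra.
Import Order.TTheory GRing.Theory Num.Theory.
Import numFieldNormedType.Exports.
Local Open Scope classical_set_scope.
Local Open Scope ring_scope.

(** If [u < v < -1], cancelling [expR u] gives [v * expR (v - u) = u]. As [v < 0] and
    [expR (v - u) > 1 + (v - u)], it follows that [u < v * (1 + v - u)], hence [-1 < v], a
    contradiction. *)
Lemma mulr_expR_inj_ltN1 (R : realType) (u v : R) :
  u < -1 -> v < -1 -> u * expR u = v * expR v -> u = v.
Proof.
wlog uv : u v / u <= v => [hw hu hv e|hu hv e].
  by have [uv|/ltW vu] := leP u v; [exact: hw|apply/esym/hw].
apply/eqP; rewrite eq_le uv /= leNgt; apply/negP => {}uv.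
have he : v * expR (v - u) = u.
  by apply: (mulIf (lt0r_neq0 (expR_gt0 u))); rewrite -mulrA -expRD subrK e.
have := @expR_gt1Dx R (v - u); rewrite subr_eq0 gt_eqF// => /(_ isT).
nra.
Qed.

(** A witness together with injectivity below -1 pins down the value chosen by [xget], so the
    default 0 does not arise. *)
Lemma lambertWm1_eq (R : realType) (w x : R) :
  w < -1 -> w * expR w = x -> lambertWm1 x = w.
Proof.
move=> hw hx; apply: xget_unique => // v [hv hvx].
by apply: mulr_expR_inj_ltN1; rewrite ?hx.
Qed.

Lemma distortionE (R : realType) (sigma N p k : R) : 0 < 1 + p / N ->
  distortion sigma N p k = sigma ^+ 2 * expR (- (k * ln (1 + p / N))).
Proof. by move=> h; rewrite /distortion /powR gt_eqF// mulNr. Qed.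

Lemma derive1_distortion (R : realType) (sigma N p k : R) : 0 < 1 + p / N ->
  derive1 (distortion sigma N p) k =
  - (ln (1 + p / N) * distortion sigma N p k).
Proof.
move=> h; set l := ln (1 + p / N).
have -> : distortion sigma N p =
    (fun k => sigma ^+ 2 * expR (- (k * l))) :> (R -> R).
  by apply/funext => k'; exact: distortionE.
rewrite derive1E; apply: derive_val.
apply: is_derive_eq; rewrite /GRing.scale /=; ring.
Qed.

(** Turns the constancy of [kappa z * l z] into opposite monotonicity of the two factors. *)
Lemma ler_eq_prod (R : realFieldType) (a b a' b' : R) :
  0 < a -> 0 < b -> 0 < a' -> 0 < b' -> a * b = a' * b' ->
  (a <= a') = (b' <= b).
Proof. by move=> *; apply/idP/idP => ?; nra. Qed.

Theorem mainTheorem6 (R : realType) (sigma N L beta : R) (p kappa : R -> R)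
    (hsigma : 0 < sigma ^+ 2) (hN : 0 < N) (hL : 0 < L)
    (hp : forall z : R, z \in `]0, L] -> 0 < p z)
    (hkappa : forall z : R, z \in `]0, L] -> 0 < kappa z)
    (hbeta : forall z : R, z \in `]0, L] ->
       distortion sigma N (p z) (kappa z)
       - derive1 (fun k : R => distortion sigma N (p z) k) (kappa z) * kappa z
       + beta = 0) :
  [/\ - sigma ^+ 2 < beta /\ beta < 0,
      forall z : R, z \in `]0, L] ->
        kappa z = - ((lambertWm1 (beta / (sigma ^+ 2 * expR 1)) + 1)
                     / ln (1 + p z / N)),
      [/\ {in `]0, L] &, {homo p : x y / x < y}} <->
            {in `]0, L] &, {homo kappa : x y /~ x < y}},
          {in `]0, L] &, {homo p : x y /~ x < y}} <->
            {in `]0, L] &, {homo kappa : x y / x < y}},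
          {in `]0, L] &, {homo p : x y / x <= y}} <->
            {in `]0, L] &, {homo kappa : x y /~ x <= y}} &
          {in `]0, L] &, {homo p : x y /~ x <= y}} <->
            {in `]0, L] &, {homo kappa : x y / x <= y}}] &
      forall z : R, z \in `]0, L] ->
        distortion sigma N (p z) (kappa z) =
        sigma ^+ 2 * expR (lambertWm1 (beta / (sigma ^+ 2 * expR 1)) + 1)].
Proof.
set W := lambertWm1 _; set s := sigma ^+ 2 in hsigma W *.
pose l z := ln (1 + p z / N).
have hpN z : z \in `]0, L] -> 0 < p z / N by move=> /hp ?; exact: divr_gt0.
have h1 z : z \in `]0, L] -> 0 < 1 + p z / N.
  by move=> /hpN ?; rewrite addr_gt0.
have hl z : z \in `]0, L] -> 0 < l z.
  by move=> /hpN ?; rewrite ln_gt0// ltrDl.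
have ht z : z \in `]0, L] -> 0 < kappa z * l z.
  by move=> hz; rewrite mulr_gt0 ?hkappa ?hl.
have hD z : z \in `]0, L] ->
    distortion sigma N (p z) (kappa z) = s * expR (- (kappa z * l z)).
  by move=> hz; rewrite distortionE ?h1.
have hb z : z \in `]0, L] ->
    beta = - (s * ((1 + kappa z * l z) * expR (- (kappa z * l z)))).
  move=> hz; have := hbeta z hz.
  rewrite derive1_distortion ?h1// hD// -/(l z) => /eqP.
  rewrite addrC addr_eq0 => /eqP ->; ring.
(* [W] does not mention [z], so this also says that [kappa z * l z] is the same for all [z]. *)
have hW z : z \in `]0, L] -> W = - (kappa z * l z) - 1.
  move=> hz; apply: lambertWm1_eq; first by have := ht z hz; lra.
  rewrite expRB {1}(hb z hz).
  by field; rewrite gt_eqF// gt_eqF// expR_gt0.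
(* The bounds on [beta] need one point of the interval; [L] serves. *)
have hL0 : L \in `]0, L] by rewrite in_itv /= hL lexx.
have hmono x y : x \in `]0, L] -> y \in `]0, L] ->
    (kappa x <= kappa y) = (p y <= p x).
  move=> hx hy; rewrite (@ler_eq_prod _ _ (l x) _ (l y)) ?hl ?hkappa//.
    by rewrite ler_ln ?posrE ?h1// lerD2l ler_pM2r ?invr_gt0.
  (* Both products equal [- W - 1]. *)
  by have := hW x hx; rewrite (hW y hy); lra.
have hmonolt x y : x \in `]0, L] -> y \in `]0, L] ->
    (kappa x < kappa y) = (p y < p x).
  by move=> hx hy; rewrite !ltNge hmono.
split.
- rewrite (hb L hL0); set t := kappa L * l L.
  have t0 : 0 < t := ht L hL0.
  (* Since [beta = - s * (1 + t) * expR (- t)], the lower bound is [1 + t < expR t], strict because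
     [t] is nonzero. *)
  have hlt : (1 + t) * expR (- t) < 1.
    by rewrite expRN ltr_pdivrMr ?expR_gt0// mul1r expR_gt1Dx// gt_eqF.
  have hgt : 0 < (1 + t) * expR (- t) by rewrite mulr_gt0 ?expR_gt0// addr_gt0.
  by rewrite ltrN2 oppr_lt0 gtr_pMr// hlt mulr_gt0.
- move=> z hz; rewrite (hW z hz) -/(l z) subrK mulNr opprK mulfK//.
  by rewrite gt_eqF ?hl.
(* Monotonicity is taken strictly and weakly, with either function increasing. The comparisons
   [hmono] and [hmonolt] are equalities of booleans, so each also yields the converse. *)
- split; split=> h x y hx hy xy.
  + by rewrite hmonolt//; apply: h.
  + by rewrite -hmonolt//; apply: h.
  + by rewrite hmonolt//; apply: h.
  + by rewrite -hmonolt//; apply: h.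
  + by rewrite hmono//; apply: h.
  + by rewrite -hmono//; apply: h.
  + by rewrite hmono//; apply: h.
  + by rewrite -hmono//; apply: h.
- by move=> z hz; rewrite hD// (hW z hz) subrK.
Qed.
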